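(* Let $m\ge 1$ and $n\ge 1$ be integers, let $\mathbf a=[a_1,\dots,a_{2n}]$ be a sequence of positive integers, and let $\overline{\mathcal G}=\overline{\mathcal G}[a_1,\dots,a_{2n}]$ be the corresponding (planar) band graph. Then the good $m$-dimer partition function of $\overline{\mathcal G}$ (with respect to the South-West weighting) satisfies $$\overline{\mathcal Z}_{\overline{\mathcal G},m}(q)=q^{-m\sum_{i=1}^{n}a_{2i}}\;\operatorname{tr}\bigl(X^{(m)}_{\mathbf a}(q)\bigr).$$
   Context: **Snake graphs.** Let $a_1,\dots,a_k\ge 1$ be integers, $N=a_1+\dots+a_k$. The snake graph $\mathcal G[a_1,\dots,a_{k-1},a_k+1]$ is the planar graph (subgraph of the grid $\mathbb Z^2$) formed by the vertices and edges of $N$ unit square tiles $T_1,\dots,T_N$ as follows. The tiles are grouped consecutively into $k$ blocks, the $i$-th block having $a_i$ tiles (''the block of $a_i$''). $T_1$ has lower-left corner $(0,0)$. Define directions $d_0,d_1,\dots,d_N\in\{\text{North},\text{East}\}$ by $d_0=\text{North}$ and, for $1\le i\le N$: $d_i\neq d_{i-1}$ if $T_i$ is not the last tile of its block, and $d_i=d_{i-1}$ if $T_i$ is the last tile of its block. For $1\le i<N$, $T_{i+1}$ is the translate of $T_i$ by one unit in direction $d_i$ (so $T_i$ and $T_{i+1}$ share an edge). Vertices $(x,y)$ are colored black if $x+y$ is even and white otherwise. Let $a=(0,0)$ (black), $b=(1,0)$ (white) be the endpoints of the south edge of $T_1$. Let the exit edge be the north edge of $T_N$ if $d_N$ is North and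 the east edge of $T_N$ if $d_N$ is East; $a'$ denotes its black endpoint and $b'$ its white endpoint. **Band graphs.** For $a_1,\dots,a_{2n}\ge1$, the band graph $\overline{\mathcal G}[a_1,\dots,a_{2n}]$ is obtained from the snake graph $\mathcal G[a_1,\dots,a_{2n-1},a_{2n}+1]$ by gluing the edge $(ab)$ to the edge $(a'b')$ with $a$ identified with $a'$ and $b$ with $b'$ (parallel edges, if any arise, are kept distinct). It is a planar bipartite graph. **South-West weighting $\omega_{\mathrm{SW}}$.** For a tile in a block of odd index $a_{2i-1}$, each west or south edge of the tile lying on the boundary of the snake graph (i.e. belonging to only one tile) gets weight $q$, except the south edge of $T_1$. For a tile in a block of even index $a_{2i}$, each west or south edge of the tile lying on the boundary gets weight $q^{-1}$. All other edges, including the glued edge $(ab)=(a'b')$, get weight $1$. This induces a weighting on the edges of the band graph. **Good matchings and good $m$-dimer covers.** Let $P$ be a perfect matching of the underlying snake graph $\mathcal G[a_1,\dots,a_{2n-1},a_{2n}+1]$ containing at least one of $(ab)$, $(a'b')$. If $P$ contains exactly one of them, remove it and take the image of the remaining edges in $\overline{\mathcal G}$; if $P$ contains both, take the image of $P$ in $\overline{\mathcal G}$, with the glued edge included once. The perfect matchings of $\overline{\mathcal G}$ obtained this way are the good matchings. A good $m$-dimer cover of $\overline{\mathcal G}$ is a multiset $M$ of edges of $\overline{\mathcal G}$ with multiplicity function $\operatorname{mult}_M=\sum_{i=1}^m\operatorname{mult}_{P_i}$ for some (not necessarily distinct) good matchings $P_1,\dots,P_m$, where $\operatorname{mult}_{P_i}$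 is the indicator function of $P_i$. Multisets with the same multiplicity function are the same good $m$-dimer cover. Let $\overline{\mathcal D}_{\overline{\mathcal G},m}$ be the set of good $m$-dimer covers. The good $m$-dimer partition function is $$\overline{\mathcal Z}_{\overline{\mathcal G},m}(q)=\sum_{M\in\overline{\mathcal D}_{\overline{\mathcal G},m}}\ \prod_{e\in E(\overline{\mathcal G})}\omega_{\mathrm{SW}}(e)^{\operatorname{mult}_M(e)}.$$ **Matrices.** All matrices are $(m+1)\times(m+1)$. $R_m$ has $(i,j)$ entry $1$ if $i\le j$ and $0$ otherwise; $L_m$ has $(i,j)$ entry $1$ if $i\ge j$ and $0$ otherwise; $Q_m=\operatorname{diag}(q^m,q^{m-1},\dots,q,1)$; $R_m(q)=R_mQ_m$; $L_m(q)=L_mQ_m$; $W_m$ is the anti-diagonal permutation matrix (ones on the anti-diagonal, zeros elsewhere). Put $\Lambda_m^+(q,a)=R_m(q)^aW_m$, $\Lambda_m^-(q,a)=W_mL_m(q)^a$ and $$X^{(m)}_{\mathbf a}(q)=\Lambda^+_m(q,a_1)\Lambda^-_m(q,a_2)\cdots\Lambda^+_m(q,a_{2n-1})\Lambda^-_m(q,a_{2n}),$$ which equals $R_m(q)^{a_1}L_m(q)^{a_2}\cdots R_m(q)^{a_{2n-1}}L_m(q)^{a_{2n}}$. *)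

(* Defs.v *)
From mathcomp Require Import all_boot all_order all_algebra.

Set Implicit Arguments.
Unset Strict Implicit.
Unset Printing Implicit Defensive.

Import GRing.Theory.
Local Open Scope nat_scope.

(* Grid geometry.  An edge (v, d) joins v to step d v, so every unit edge of  *)
(* the grid has exactly one name.                                             *)

Definition direction := bool.
Definition North : direction := true.
Definition East : direction := false.

Definition point := (nat * nat)%type.
Definition grid_edge := (point * direction)%type.

Definition step (d : direction) (v : point) : point :=
  if d == North then (v.1, v.2.+1) else (v.1.+1, v.2).

Definition ends (e : grid_edge) : seq point := [:: e.1; step e.2 e.1].

Definition black (v : point) : bool := ~~ odd (v.1 + v.2).
Definition black_end (e : grid_edge) : point :=
  if black e.1 then e.1 else step e.2 e.1.
Definition white_end (e : grid_edge) : point :=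
  if black e.1 then step e.2 e.1 else e.1.

Definition south_edge (c : point) : grid_edge := (c, East).
Definition west_edge (c : point) : grid_edge := (c, North).
Definition north_edge (c : point) : grid_edge := (step North c, East).
Definition east_edge (c : point) : grid_edge := (step East c, North).

(* The snake graph G[a_1, ..., a_(k-1), a_k + 1], for a = [:: a_1; ...; a_k]. *)
(* Blocks and tiles are numbered from 0: tile t is T_(t+1), and block i is    *)
(* the block of a_(i+1).                                                      *)

Section SnakeGraph.
Variable a : seq nat.

Definition num_tiles : nat := sumn a.

Definition block (t : nat) : nat := reshape_index a t.
Definition last_in_block (t : nat) : bool :=
  (reshape_offset a t).+1 == nth 0 a (block t).

(* dir i is d_i: d_0 = North, and dir t.+1 is the direction leaving tile t. *)
Fixpoint dir (i : nat) : direction :=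
  if i is t.+1 then (if last_in_block t then dir t else ~~ dir t) else North.

(* South-west corner of tile t. *)
Fixpoint corner (t : nat) : point :=
  if t is s.+1 then step (dir s.+1) (corner s) else (0, 0).

Definition tile_edges (t : nat) : seq grid_edge :=
  let c := corner t in
  [:: south_edge c; west_edge c; north_edge c; east_edge c].

Definition snake_edges : seq grid_edge :=
  flatten [seq tile_edges t | t <- iota 0 num_tiles].
Definition snake_vertices : seq point :=
  flatten [seq ends e | e <- snake_edges].

Definition edge_ab : grid_edge := south_edge (0, 0).
Definition exit_edge : grid_edge :=
  let c := corner num_tiles.-1 in
  if dir num_tiles == North then north_edge c else east_edge c.

Definition boundary (e : grid_edge) : bool :=
  count (fun t => e \in tile_edges t) (iota 0 num_tiles) == 1.

(* e is the west or the south edge of a tile in a block whose 0-based index   *)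
(* has parity b; b = false are the blocks of a_1, a_3, ...                    *)
Definition is_south_west (b : bool) (e : grid_edge) : bool :=
  has (fun t => (odd (block t) == b) &&
                (e \in [:: south_edge (corner t); west_edge (corner t)]))
      (iota 0 num_tiles).

Definition sw_weight (R : comUnitRingType) (q : R) (e : grid_edge) : R :=
  if ~~ boundary e || (e == edge_ab) then 1%R
  else if is_south_west false e then q
  else if is_south_west true e then (q^-1)%R
  else 1%R.

End SnakeGraph.

(* A finite multigraph is given by its vertices V, its edges E, and the       *)
(* incidence relation between them.                                           *)
Definition perfect_matching (V E : finType) (inc : E -> V -> bool)
    (P : {set E}) : bool :=
  [forall v, #|[set e in P | inc e v]| == 1].

Section BandGraph.
Variable a : seq nat.

Definition snake_vertex : finType := seq_sub (snake_vertices a).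
Definition snake_edge : finType := seq_sub (snake_edges a).
Definition snake_inc (e : snake_edge) (v : snake_vertex) : bool :=
  val v \in ends (val e).

(* The quotient is realised on representatives: a', b' and the edge (a'b')    *)
(* are sent to a, b and (ab), and everything else is left alone.  As edges    *)
(* keep their names in the grid, parallel edges remain distinct.              *)
Definition glue_vertex (v : point) : point :=
  if v == black_end (exit_edge a) then black_end edge_ab
  else if v == white_end (exit_edge a) then white_end edge_ab
  else v.
Definition glue_edge (e : grid_edge) : grid_edge :=
  if e == exit_edge a then edge_ab else e.

Definition band_vertex : finType :=
  seq_sub [seq glue_vertex v | v <- snake_vertices a].
Definition band_edge : finType :=
  seq_sub [seq glue_edge e | e <- snake_edges a].
Definition band_inc (e : band_edge) (v : band_vertex) : bool :=
  val v \in [seq glue_vertex u | u <- ends (val e)].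

Definition to_band (e : snake_edge) : band_edge :=
  SeqSub (map_f glue_edge (valP e)).

Definition contains (P : {set snake_edge}) (e : grid_edge) : bool :=
  [exists x in P, val x == e].

Definition band_image (P : {set snake_edge}) : {set band_edge} :=
  if contains P edge_ab && contains P (exit_edge a) then to_band @: P
  else to_band @: [set x in P | val x \notin [:: edge_ab; exit_edge a]].

Definition good_matching (S : {set band_edge}) : bool :=
  perfect_matching band_inc S &&
  [exists P : {set snake_edge},
     [&& perfect_matching snake_inc P,
         contains P edge_ab || contains P (exit_edge a)
       & S == band_image P]].

(* Multisets of edges are given by their multiplicity functions; a sum of m   *)
(* indicator functions never exceeds m, so values in 'I_m.+1 suffice.         *)
Definition good_dimer_cover (m : nat) (M : {ffun band_edge -> 'I_m.+1}) : bool :=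
  [exists P : {ffun 'I_m -> {set band_edge}},
     [forall i, good_matching (P i)] &&
     [forall e, val (M e) == \sum_(i < m) (e \in P i)]].

(* The representative (ab) of the glued edge has weight 1, and so does (a'b') *)
(* as it is a north or an east edge, so sw_weight is well defined on band     *)
(* edges.                                                                     *)
Definition good_partition (m : nat) (R : comUnitRingType) (q : R) : R :=
  (\sum_(M : {ffun band_edge -> 'I_m.+1} | good_dimer_cover M)
     \prod_(e : band_edge) sw_weight a q (val e) ^+ (M e))%R.

End BandGraph.

Section Matrices.
Variables (R : comUnitRingType) (m : nat) (q : R).
Local Open Scope ring_scope.

Definition Rmx : 'M[R]_m.+1 := \matrix_(i, j) (i <= j)%N%:R.
Definition Lmx : 'M[R]_m.+1 := \matrix_(i, j) (j <= i)%N%:R.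
Definition Qmx : 'M[R]_m.+1 := diag_mx (\row_i q ^+ (m - i)).
Definition Wmx : 'M[R]_m.+1 := \matrix_(i, j) (i + j == m)%N%:R.
Definition Rq : 'M[R]_m.+1 := Rmx *m Qmx.
Definition Lq : 'M[R]_m.+1 := Lmx *m Qmx.

Definition Lambda_plus (k : nat) : 'M[R]_m.+1 := Rq ^+ k *m Wmx.
Definition Lambda_minus (k : nat) : 'M[R]_m.+1 := Wmx *m Lq ^+ k.

Definition Xmx (n : nat) (a : seq nat) : 'M[R]_m.+1 :=
  \prod_(i < n) (Lambda_plus (nth 0%N a i.*2) *m
                 Lambda_minus (nth 0%N a i.*2.+1)).

End Matrices.

(* Main.v *)
Require Import Defs.
From mathcomp Require Import all_boot all_order all_algebra.
From mathcomp Require Import zify.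

(** Cut the snake graph along its levels, the lines x + y = t. Tile t (tiles
    are numbered from 0) has its south-west corner on level t and its
    north-west and south-east corners on level t + 1; these two are all the
    vertices of level t + 1. Between levels t and t + 1 there are three edges
    (two at either end of the graph): the rung shared by tiles t - 1 and t, the
    remaining south or west edge [sw t] of tile t, and the remaining north or
    east edge [ne (t - 1)] of tile t - 1. Since the levels have 1, 2, ..., 2, 1
    vertices, a perfect matching selects exactly one edge between any two
    consecutive levels. The two boundary edges of a tile are opposite sides if
    the tile ends a block, and are then selected together; otherwise they meet
    at a vertex of degree two, so that exactly one of them is selected
    ([perfect_matching_levels]).

    Gluing closes the levels into a cycle, and a matching is good precisely
    when the merged first and last levels also select exactly one edge. A good
    matching is therefore encoded by the function h on the tiles that tells
    whether [sw t] is selected: h determines the other multiplicities, and the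
    only constraint is that the multiplicities of the rungs are nonnegative
    ([good_matchingP]).

    This description is linear, so a sum of m good matchings satisfies it with
    1 replaced by m. Conversely, replace h by m - h on the tiles of
    even-numbered blocks: the constraint then says that the new function
    weakly decreases along the blocks of a_1, a_3, ... and weakly increases
    along those of a_2, a_4, .... Order conditions pass to threshold
    functions, and the m thresholds of h are m good matchings with sum h
    ([good_dimer_coverP]). Good m-dimer covers are thus the same as admissible
    functions h, and as only the edges [sw t] carry a nontrivial weight, the
    weight of a cover is the product of the q^(h t) or q^(- h t).

    On the other side, the trace of a product of N matrices is the sum over
    closed walks of length N in {0, ..., m}. The entries of R_m(q) and L_m(q)
    force a walk f to increase weakly at the letters R and to decrease weakly
    at the letters L, with weight q^(m - f t) at each step. Putting f = m - h
    at the letters R and f = h at the letters L turns closed walks into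
    admissible functions, and the weights agree up to the factor q^m for each
    letter L ([walk_weight]). *)

Set Implicit Arguments.
Unset Strict Implicit.
Unset Printing Implicit Defensive.

Import GRing.Theory.
Local Open Scope nat_scope.

(** * Preliminaries *)

Definition cyclic_pred (N t : nat) : nat := if t is s.+1 then s else N.-1.

Lemma step_eq (d d' : direction) (v : point) :
  (step d v == step d' v) = (d == d').
Proof. by case: d d' v => [] [] [x y]; rewrite /step /= xpair_eqE; lia. Qed.

Lemma stepC (d d' : direction) (v : point) :
  step d (step d' v) = step d' (step d v).
Proof. by case: d; case: d'. Qed.

Definition level (v : point) : nat := v.1 + v.2.

Lemma level_step (d : direction) (v : point) : level (step d v) = (level v).+1.
Proof. by case: d; rewrite /level /step /= ?addnS ?addSn. Qed.

(** Turns a degree in a graph whose edges form a [seq_sub] into a count over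
    any explicit list that contains the edges concerned. *)
Lemma card_set_seq_sub (T : choiceType) (s es : seq T) (A : {set seq_sub s})
    (Q : pred T) :
  uniq es -> (forall e, e \in s -> Q e -> e \in es) ->
  #|[set x in A | Q (val x)]| =
  count (fun e => [exists x in A, val x == e] && Q e) es.
Proof.
move=> Ues ses; rewrite cardE -(size_map val) -size_filter.
apply/perm_size/uniq_perm; rewrite ?filter_uniq //.
  by rewrite map_inj_uniq ?enum_uniq //; apply: val_inj.
move=> e; rewrite mem_filter; apply/mapP/andP.
  case=> x; rewrite mem_enum inE => /andP[xA Qx] ->; split.
    by rewrite Qx andbT; apply/existsP; exists x; rewrite xA /=.
  exact: ses (valP x) Qx.
case=> /andP[/existsP[x /andP[xA /eqP xe]] Qe] _.
by exists x; rewrite // mem_enum inE xA xe.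
Qed.

(** One past the last tile, the block number is the number of blocks; in a band
    it is even, like the number 0 of the block that follows cyclically. *)
Lemma reshape_index_sumn (s : seq nat) : reshape_index s (sumn s) = size s.
Proof.
suff gen k : sumn s < k -> find (pred1 0) (scanl subn k s) = size s.
  exact: gen.
elim: s k => //= x s IH k sk.
by rewrite subn_eq0 leqNgt (leq_ltn_trans (leq_addr _ _) sk) /= IH //; lia.
Qed.

(** * Traces of matrix products as sums over closed walks *)

Section Trace.
Local Open Scope ring_scope.
Variables (R : comUnitRingType) (m : nat).

(** The default values of [nth] are never reached: [i :: l] lists the positions
    of a walk from i, and step t goes from its entry t to its entry t + 1. *)
Lemma prod_mx_walk (A : nat -> 'M[R]_m.+1) N (i j : 'I_m.+1) :
  (\prod_(t < N) A t) i j =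
  \sum_(l : N.-tuple 'I_m.+1 | last i l == j)
     \prod_(t < N) A t (nth ord0 (i :: l) t) (nth ord0 l t).
Proof.
elim: N A i => [|N IH] A i.
  rewrite big_ord0 mxE big_mkcond (big_pred1 [tuple]) => [|l]; last first.
    by rewrite (tuple0 l) /= eq_refl.
  by rewrite big_ord0 /=; case: eqP.
rewrite big_ord_recl mxE.
under eq_bigr => k _ do rewrite (IH (A \o S)) big_distrr /=.
rewrite (reindex
  (fun p : 'I_m.+1 * N.-tuple 'I_m.+1 => [tuple of p.1 :: p.2])) /=.
  rewrite pair_big_dep /=; apply: eq_bigr => p _.
  by rewrite big_ord_recl.
exists (fun l => (thead l, [tuple of behead l])) => [[k l] _|l _].
  by congr (_, _); apply: val_inj.
by rewrite -tuple_eta.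
Qed.

(** For a closed walk the starting point is the last entry of l, so the walk is
    given by l alone, read cyclically. *)
Lemma trace_prod_mx (A : nat -> 'M[R]_m.+1) N : (0 < N)%N ->
  \tr (\prod_(t < N) A t) =
  \sum_(l : N.-tuple 'I_m.+1)
     \prod_(t < N) A t (nth ord0 l (cyclic_pred N t)) (nth ord0 l t).
Proof.
move=> N_gt0; rewrite /mxtrace.
under eq_bigr do rewrite prod_mx_walk big_mkcond.
rewrite exchange_big /=; apply: eq_bigr => l _.
have lastE i : last i l = nth ord0 l N.-1.
  case: N N_gt0 l => // N _ l; rewrite (last_nth ord0) size_tuple /=.
  by rewrite -[RHS]/(nth ord0 (i :: l) N.+1).
rewrite -big_mkcond (big_pred1 (nth ord0 l N.-1)) /= => [|i]; last first.
  by rewrite /= lastE eq_sym.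
by apply: eq_bigr => -[[|t] tN].
Qed.

Lemma Wmx_invol : Wmx R m *m Wmx R m = 1%:M.
Proof.
apply/matrixP => i j; rewrite !mxE (bigD1 (rev_ord i)) //= !mxE big1 ?addr0.
  have i_rev : (i + rev_ord i = m)%N by have := ltn_ord i; rewrite /=; lia.
  rewrite i_rev eqxx mul1r; congr (_%:R); rewrite -val_eqE.
  by move: (rev_ord i : nat) i_rev => k /= i_k; apply/eqP/eqP; lia.
move=> k ki; rewrite !mxE (_ : (i + k == m)%N = false) ?mul0r //.
apply: contraNF ki => /eqP ikm; apply/eqP/val_inj => /=.
by rewrite subSS; lia.
Qed.

Lemma Rq_entry (q : R) i j : Rq m q i j = (i <= j)%N%:R * q ^+ (m - j).
Proof. by rewrite /Rq /Qmx mul_mx_diag !mxE. Qed.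

Lemma Lq_entry (q : R) i j : Lq m q i j = (j <= i)%N%:R * q ^+ (m - j).
Proof. by rewrite /Lq /Qmx mul_mx_diag !mxE. Qed.

Lemma Xmx_word (q : R) n a :
  Xmx m q n a =
  \prod_(i < n) (Rq m q ^+ nth 0%N a i.*2 * Lq m q ^+ nth 0%N a i.*2.+1).
Proof.
apply: eq_bigr => i _; rewrite /Lambda_plus /Lambda_minus.
by rewrite -mulmxA (mulmxA (Wmx R m)) Wmx_invol mul1mx mulmxE.
Qed.

End Trace.

(** * The word of block parities *)

Section BandGraph.
Variable a : seq nat.

(** [true] on the blocks of a_2, a_4, ..., whose tiles stand for letters L. *)
Definition label (t : nat) : bool := odd (block a t).

(** Serves twice: with matrices it reads the product of the letters as [Xmx],
    with scalars it collects the powers of q. *)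
Lemma prod_labels (S : pzSemiRingType) (F : bool -> S) n : size a = n.*2 ->
  (\prod_(t < num_tiles a) F (label t) =
   \prod_(i < n) (F false ^+ nth 0%N a i.*2 * F true ^+ nth 0%N a i.*2.+1))%R.
Proof.
move=> size_a.
have block_run r : r < size a ->
    (\prod_(sumn (take r a) <= t < sumn (take r.+1 a)) F (label t) =
     F (odd r) ^+ nth 0%N a r)%R.
  move=> ra; rewrite (take_nth 0) // sumn_rcons.
  rewrite -{1}[sumn _]add0n big_addn addKn.
  rewrite -[in RHS](subn0 (nth _ _ _)) -prodr_const_nat.
  apply: eq_big_nat => c /= ca.
  by rewrite /label /block addnC [reshape_index _ _]flatten_indexKl.
rewrite -(big_mkord xpredT (fun t => F (label t))).
suff IH k : k <= n -> (\prod_(0 <= t < sumn (take k.*2 a)) F (label t) =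
   \prod_(i < k) (F false ^+ nth 0%N a i.*2 * F true ^+ nth 0%N a i.*2.+1))%R.
  by rewrite -IH // -size_a take_size.
elim: k => [_|k IH kn]; first by rewrite take0 big_geq ?big_ord0.
have mono r : sumn (take r a) <= sumn (take r.+1 a).
  have [ra|ra] := ltnP r (size a); last by rewrite !take_oversize // ltnW.
  by rewrite (take_nth 0) // sumn_rcons leq_addr.
rewrite big_ord_recr /= -IH ?(ltnW kn) // doubleS.
rewrite (@big_cat_nat _ _ _ (sumn (take k.*2 a))) //=; last first.
  exact: leq_trans (mono _) (mono _).
congr (_ * _)%R; rewrite (@big_cat_nat _ _ _ (sumn (take k.*2.+1 a))) //=.
by rewrite !block_run /= ?odd_double ?size_a //; lia.
Qed.

Hypothesis a_band : [&& all (fun x => 0 < x) a, 0 < size a & ~~ odd (size a)].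

Let a_gt0 : all (fun x => 0 < x) a. Proof. by case/and3P: a_band. Qed.
Let a_nonempty : 0 < size a. Proof. by case/and3P: a_band. Qed.
Let a_even : ~~ odd (size a). Proof. by case/and3P: a_band. Qed.

(** * Edges and vertices by level *)

Local Notation N := (num_tiles a).
Local Notation corner := (corner a).
Local Notation dir := (dir a).

(** The edge through which tile t is entered: the edge shared with the previous
    tile, (ab) for the first one, and the exit edge for t = N. *)
Definition rung (t : nat) : grid_edge := (corner t, ~~ dir t).
Definition sw (t : nat) : grid_edge := (corner t, dir t).
(** The side of tile t that is neither [rung t], [sw t] nor [rung t.+1]. *)
Definition ne (t : nat) : grid_edge :=
  (step (~~ dir t.+1) (corner t), dir t.+1).

Definition rung_end (t : nat) : point := step (~~ dir t) (corner t).
Definition sw_end (t : nat) : point := step (dir t) (corner t).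

Definition straight (t : nat) : bool := last_in_block a t.

Lemma cornerS t :
  corner t.+1 = if straight t then sw_end t else rung_end t.
Proof. by rewrite /= -/(straight t); case: ifP. Qed.

(** The two vertices of level t + 1 are [rung_end t] and [sw_end t]; the next
    tile has its corner at one of them, and [ne t] starts at the other. *)
Lemma ne_start t :
  (ne t).1 = if straight t then rung_end t else sw_end t.
Proof.
by rewrite /ne /= -/(straight t); case: ifP; rewrite ?negbK.
Qed.

Lemma ends_rung t : ends (rung t) = [:: corner t; rung_end t].
Proof. by []. Qed.
Lemma ends_sw t : ends (sw t) = [:: corner t; sw_end t].
Proof. by []. Qed.
Lemma ends_ne t : ends (ne t) = [:: (ne t).1; rung_end t.+1].
Proof.
by rewrite /ends; congr [:: _; _]; rewrite /ne /rung_end stepC.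
Qed.

Lemma rung_endDsw_end t : rung_end t != sw_end t.
Proof. by rewrite /rung_end /sw_end step_eq; case: dir. Qed.

Lemma level_corner t : level (corner t) = t.
Proof. by elim: t => //= t IH; rewrite level_step IH. Qed.
Lemma level_rung_end t : level (rung_end t) = t.+1.
Proof. by rewrite level_step level_corner. Qed.
Lemma level_sw_end t : level (sw_end t) = t.+1.
Proof. by rewrite level_step level_corner. Qed.
Lemma level_ne t : level (ne t).1 = t.+1.
Proof. by rewrite level_step level_corner. Qed.

Lemma rung_eq t t' : (rung t == rung t') = (t == t').
Proof.
apply/eqP/eqP => [/(congr1 (fun e : grid_edge => level e.1))|-> //].
by rewrite !level_corner.
Qed.
Lemma sw_eq t t' : (sw t == sw t') = (t == t').
Proof.
apply/eqP/eqP => [/(congr1 (fun e : grid_edge => level e.1))|-> //].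
by rewrite !level_corner.
Qed.
Lemma ne_eq t t' : (ne t == ne t') = (t == t').
Proof.
apply/eqP/eqP => [/(congr1 (fun e : grid_edge => level e.1))|-> //].
by rewrite !level_ne => -[].
Qed.
Lemma rung_sw t t' : (rung t == sw t') = false.
Proof.
apply/eqP => -[/(congr1 level)]; rewrite !level_corner => ->.
by case: dir.
Qed.
(** [ne t] starts at the vertex of its level that is not a corner of a tile,
    which tells it apart from every [rung] and [sw]. *)
Lemma ne_corner t t' d : (ne t == (corner t', d)) = false.
Proof.
apply/eqP => -[] /[dup] /(congr1 level).
rewrite level_step !level_corner => <- /eqP.
by rewrite [corner t.+1]/= step_eq; case: (if _ then _ else _).
Qed.
Lemma ne_rung t t' : (ne t == rung t') = false.
Proof. exact: ne_corner. Qed.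
Lemma ne_sw t t' : (ne t == sw t') = false.
Proof. exact: ne_corner. Qed.

Lemma sw_rung t t' : (sw t == rung t') = false.
Proof. by rewrite eq_sym rung_sw. Qed.
Lemma rung_ne t t' : (rung t == ne t') = false.
Proof. by rewrite eq_sym ne_rung. Qed.
Lemma sw_ne t t' : (sw t == ne t') = false.
Proof. by rewrite eq_sym ne_sw. Qed.

Definition edge_eqE :=
  (rung_eq, sw_eq, ne_eq, rung_sw, ne_rung, ne_sw, sw_rung, rung_ne, sw_ne).

Lemma edge_abE : edge_ab = rung 0. Proof. by []. Qed.

Lemma rungS_north_east t :
  rung t.+1 = if dir t.+1 == North then north_edge (corner t)
              else east_edge (corner t).
Proof.
rewrite /rung (_ : corner t.+1 = step (dir t.+1) (corner t)) //.
by case: (dir t.+1).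
Qed.

Lemma N_gt0 : 0 < N.
Proof.
rewrite /num_tiles; case: a a_gt0 a_nonempty => //= x s /andP[x_gt0 _] _.
by rewrite addn_gt0 x_gt0.
Qed.

Lemma exit_edgeE : exit_edge a = rung N.
Proof.
have -> : rung N = rung N.-1.+1 by rewrite prednK ?N_gt0.
by rewrite rungS_north_east prednK ?N_gt0.
Qed.

Lemma mem_tile_edges t e :
  (e \in tile_edges a t) =
  [|| e == rung t, e == sw t, e == ne t | e == rung t.+1].
Proof.
rewrite rungS_north_east /tile_edges /rung /sw /ne !inE.
rewrite /south_edge /west_edge /north_edge /east_edge.
by case: (dir t); case: (dir t.+1) => /=; do 4!case: (_ == _).
Qed.

Variant edge_spec : grid_edge -> Prop :=
| RungSpec t of t <= N : edge_spec (rung t)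
| SwSpec t of t < N : edge_spec (sw t)
| NeSpec t of t < N : edge_spec (ne t).

Lemma mem_snake_edges e :
  (e \in snake_edges a) = has (fun t => e \in tile_edges a t) (iota 0 N).
Proof.
apply/flatten_mapP/hasP => -[t tN et]; exists t => //.
Qed.

Lemma snake_edgeP e : e \in snake_edges a -> edge_spec e.
Proof.
rewrite mem_snake_edges => /hasP[t]; rewrite mem_iota /= add0n => tN.
rewrite mem_tile_edges => /or4P[] /eqP->; constructor => //; exact: ltnW.
Qed.

Lemma tile_edges_sub t e : t < N -> e \in tile_edges a t -> e \in snake_edges a.
Proof.
move=> tN et; rewrite mem_snake_edges; apply/hasP; exists t => //.
by rewrite mem_iota.
Qed.

Lemma sw_snake t : t < N -> sw t \in snake_edges a.
Proof. by move=> /tile_edges_sub; apply; rewrite mem_tile_edges eqxx orbT. Qed.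
Lemma ne_snake t : t < N -> ne t \in snake_edges a.
Proof. by move=> /tile_edges_sub; apply; rewrite mem_tile_edges eqxx !orbT. Qed.
Lemma rung_snake t : t <= N -> rung t \in snake_edges a.
Proof.
rewrite leq_eqVlt => /predU1P[->|/tile_edges_sub]; last first.
  by apply; rewrite mem_tile_edges eqxx.
rewrite -(prednK N_gt0); apply: (@tile_edges_sub N.-1).
  by rewrite prednK ?N_gt0.
by rewrite mem_tile_edges eqxx !orbT.
Qed.

Lemma swN_snake : sw N \notin snake_edges a.
Proof.
apply/negP => /snake_edgeP E; move: (erefl (sw N)).
case: {-1}_ / E => t tN /eqP; rewrite !edge_eqE //.
by move=> /eqP tE; rewrite tE ltnn in tN.
Qed.

(** * Perfect matchings of the snake graph *)

(** The edges between levels t and t + 1. For t = N the list also contains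
    [sw N], which is not an edge of the snake graph ([swN_snake]). *)
Definition level_edges (t : nat) : seq grid_edge :=
  [:: rung t; sw t] ++ (if t is s.+1 then [:: ne s] else [::]).

Lemma level_edges_uniq t : uniq (level_edges t).
Proof. by case: t => [|t]; rewrite /= ?inE ?edge_eqE. Qed.

Lemma level_edges_level t e : e \in level_edges t -> level e.1 = t.
Proof.
case: t => [|t]; rewrite !inE.
  by case/orP=> /eqP->; rewrite level_corner.
by case/or3P=> /eqP->; rewrite ?level_ne ?level_corner.
Qed.

Lemma mem_level_edges e : e \in snake_edges a -> e \in level_edges (level e.1).
Proof.
case/snake_edgeP=> t tN; rewrite ?level_ne ?level_corner.
- by rewrite mem_cat !inE eqxx.
- by rewrite mem_cat !inE eqxx orbT.
- by rewrite mem_cat !inE eqxx !orbT.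
Qed.

Lemma level_ends e w :
  w \in ends e -> level w = level e.1 \/ level w = (level e.1).+1.
Proof.
by rewrite !inE => /orP[] /eqP ->; rewrite ?level_step; [left|right].
Qed.

Lemma incident_levels t e w :
  e \in snake_edges a -> w \in ends e -> level w = t.+1 ->
  e \in level_edges t ++ level_edges t.+1.
Proof.
move=> /mem_level_edges es /level_ends we wt; rewrite mem_cat.
move: we; rewrite wt => -[E|[E]]; first by rewrite E es orbT.
by rewrite E es.
Qed.

Lemma levels_uniq t : uniq (level_edges t ++ level_edges t.+1).
Proof.
rewrite cat_uniq !level_edges_uniq andTb andbT; apply/hasPn => e et.
apply/negP => /level_edges_level; rewrite (level_edges_level et); lia.
Qed.

Definition incoming (p : nat -> nat) (t : nat) : nat :=
  if t is s.+1 then p s else 0.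

Lemma count_level_edges p t :
  count p (level_edges t) = p (rung t) + p (sw t) + incoming (p \o ne) t.
Proof. by case: t => [|t] /=; rewrite ?addn0 ?addnA. Qed.

Lemma count_lower p t w :
  count (fun e => p e && (w \in ends e)) (level_edges t) =
  p (rung t) && (w \in ends (rung t)) + (p (sw t) && (w \in ends (sw t)))
   + incoming (fun s => p (ne s) && (w \in ends (ne s))) t.
Proof. by rewrite count_level_edges. Qed.

Lemma count_at_origin (p : pred grid_edge) :
  count (fun e => p e && (corner 0 \in ends e)) (level_edges 0) =
  p (rung 0) + p (sw 0).
Proof. by rewrite count_lower ends_rung ends_sw !inE !eqxx !andbT addn0. Qed.

Lemma level_neq (v w : point) : level v != level w -> (v == w) = false.
Proof. by apply: contraNF => /eqP->. Qed.

(** The next three lemmas are the incidence table between levels t, t + 1 and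
    t + 2, from which all degrees are read off. *)
Lemma rung_end_lower t :
  ((rung_end t \in ends (rung t)) = true) *
  ((rung_end t \in ends (sw t)) = false) *
  (forall s, t = s.+1 -> (rung_end t \in ends (ne s)) = true).
Proof.
rewrite ends_rung ends_sw !inE eqxx orbT (negPf (rung_endDsw_end t)) orbF.
rewrite level_neq ?level_rung_end ?level_corner ?neq_ltn ?ltnSn ?orbT //.
by do !split=> // s ->; rewrite ends_ne !inE eqxx orbT.
Qed.

Lemma sw_end_lower t :
  ((sw_end t \in ends (rung t)) = false) *
  ((sw_end t \in ends (sw t)) = true) *
  (forall s, t = s.+1 -> (sw_end t \in ends (ne s)) = false).
Proof.
have E : (sw_end t == rung_end t) = false.
  by rewrite eq_sym (negPf (rung_endDsw_end t)).
have F w : level w = t -> (sw_end t == w) = false.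
  by move=> wt; rewrite level_neq // level_sw_end wt; lia.
rewrite ends_rung ends_sw !inE eqxx orbT E !F ?level_corner //.
do !split=> // s ts; rewrite ends_ne !inE -ts E F //.
by rewrite level_ne.
Qed.

Lemma upper_incidence t w : level w = t.+1 ->
  ((w \in ends (rung t.+1)) = (w == corner t.+1)) *
  ((w \in ends (sw t.+1)) = (w == corner t.+1)) *
  ((w \in ends (ne t)) = (w == (ne t).1)).
Proof.
move=> wt; have F v : level v = t.+2 -> (w == v) = false.
  by move=> vt; rewrite level_neq // vt wt; lia.
rewrite ends_rung ends_sw ends_ne !inE.
by rewrite (F _ (level_rung_end _)) (F _ (level_sw_end _)) !orbF.
Qed.

Lemma count_at_rung_end p t :
  count (fun e => p e && (rung_end t \in ends e))
    (level_edges t ++ level_edges t.+1) =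
  p (rung t) + incoming (p \o ne) t +
  (if straight t then p (ne t) : nat else p (rung t.+1) + p (sw t.+1)).
Proof.
rewrite count_cat !count_lower !rung_end_lower.
rewrite [incoming _ t.+1]/= !(upper_incidence (level_rung_end t)).
rewrite cornerS ne_start.
rewrite !andbT !andbF addn0; congr (_ + _ + _).
  by case: t => //= t; rewrite rung_end_lower // andbT.
by case: ifP => _;
  rewrite eqxx (negPf (rung_endDsw_end t)) !(andbT, andbF) ?addn0.
Qed.

Lemma count_at_sw_end p t :
  count (fun e => p e && (sw_end t \in ends e))
    (level_edges t ++ level_edges t.+1) =
  p (sw t) +
  (if straight t then p (rung t.+1) + p (sw t.+1) else p (ne t) : nat).
Proof.
have E : (sw_end t == rung_end t) = false.
  by rewrite eq_sym (negPf (rung_endDsw_end t)).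
rewrite count_cat !count_lower !sw_end_lower.
rewrite [incoming _ t.+1]/= !(upper_incidence (level_sw_end t)).
rewrite cornerS ne_start.
rewrite !andbT !andbF add0n.
have -> : incoming (fun s => p (ne s) && (sw_end t \in ends (ne s))) t = 0.
  by case: t {E} => //= t; rewrite sw_end_lower // andbF.
rewrite addn0; congr (_ + _).
by case: ifP => _; rewrite eqxx E !(andbT, andbF) ?addn0.
Qed.

Lemma count_at_top p t :
  count (fun e => p e && (rung_end t \in ends e)) (level_edges t) =
  p (rung t) + incoming (p \o ne) t.
Proof.
rewrite count_lower !rung_end_lower andbT andbF addn0; congr (_ + _).
by case: t => //= t; rewrite rung_end_lower // andbT.
Qed.

Lemma mem_snake_vertices e w :
  e \in snake_edges a -> w \in ends e -> w \in snake_vertices a.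
Proof. by move=> es we; apply/flatten_mapP; exists e. Qed.

(** [rung_end N] is the north-east corner of the last tile. *)
Variant vertex_spec : point -> Prop :=
| OriginSpec : vertex_spec (corner 0)
| RungEndSpec t of t < N : vertex_spec (rung_end t)
| SwEndSpec t of t < N : vertex_spec (sw_end t)
| TopSpec : vertex_spec (rung_end N).

Lemma corner_spec t : t <= N -> vertex_spec (corner t).
Proof.
case: t => [_|t tN]; first exact: OriginSpec.
by rewrite cornerS; case: ifP => _; constructor.
Qed.

Lemma snake_vertexP w : w \in snake_vertices a -> vertex_spec w.
Proof.
have rung_spec t : t <= N -> vertex_spec (rung_end t).
  by rewrite leq_eqVlt => /predU1P[->|]; constructor.
case/flatten_mapP => e /snake_edgeP[] t tN.
- by rewrite ends_rung !inE => /orP[] /eqP->; auto using corner_spec.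
- rewrite ends_sw !inE => /orP[] /eqP->; last exact: SwEndSpec.
  by apply: corner_spec; apply: ltnW.
- rewrite ends_ne ne_start !inE => /orP[] /eqP->; last exact: rung_spec.
  by case: ifP => _; constructor.
Qed.

Lemma corner0_snake : corner 0 \in snake_vertices a.
Proof.
by apply: (@mem_snake_vertices (rung 0)); rewrite ?rung_snake ?inE ?eqxx.
Qed.
Lemma rung_end_snake t : t <= N -> rung_end t \in snake_vertices a.
Proof.
move=> tN; apply: (@mem_snake_vertices (rung t)); first exact: rung_snake.
by rewrite rung_end_lower.
Qed.
Lemma sw_end_snake t : t < N -> sw_end t \in snake_vertices a.
Proof.
move=> tN; apply: (@mem_snake_vertices (sw t)); first exact: sw_snake.
by rewrite sw_end_lower.
Qed.

Section Matching.
Variable P : {set snake_edge a}.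
Local Notation p := (contains P).

Lemma contains_snake e : p e -> e \in snake_edges a.
Proof. by case/existsP=> x /andP[_ /eqP <-]; apply: valP. Qed.

Lemma contains_val (x : snake_edge a) : p (val x) = (x \in P).
Proof.
apply/existsP/idP => [[y /andP[yP /eqP /val_inj <-]]|xP] //.
by exists x; rewrite xP eqxx.
Qed.

Lemma contains_swN : p (sw N) = false.
Proof. by apply: contraNF swN_snake => /contains_snake. Qed.

Lemma vertex_degree (v : snake_vertex a) (es : seq grid_edge) :
  uniq es ->
  (forall e : grid_edge, e \in snake_edges a -> val v \in ends e -> e \in es) ->
  #|[set e in P | snake_inc e v]| =
  count (fun e => p e && (val v \in ends e)) es.
Proof.
move=> Ues ves.
by rewrite (@card_set_seq_sub _ _ es P (fun e => val v \in ends e)) //.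
Qed.

Definition level_exact : Prop :=
  forall t, t <= N -> count p (level_edges t) = 1.
(** The two boundary edges of a tile are opposite sides if the tile is the last
    of its block; otherwise they share a vertex of degree two. *)
Definition tile_rule : Prop :=
  forall t, t < N -> p (ne t) = (if straight t then p (sw t) else ~~ p (sw t)).

Lemma degree_at t w (v : snake_vertex a) : val v = w -> level w = t.+1 ->
  #|[set e in P | snake_inc e v]| =
  count (fun e => p e && (w \in ends e)) (level_edges t ++ level_edges t.+1).
Proof.
move=> <- lv; apply: vertex_degree; first exact: levels_uniq.
by move=> e es ve; apply: incident_levels es ve lv.
Qed.

Lemma degree_origin (v : snake_vertex a) : val v = corner 0 ->
  #|[set e in P | snake_inc e v]| = p (rung 0) + p (sw 0).
Proof.
move=> vE; rewrite (@vertex_degree _ (level_edges 0)) ?level_edges_uniq //.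
  by rewrite vE count_at_origin.
move=> e /mem_level_edges es /level_ends; rewrite vE level_corner.
by case => // E; rewrite E.
Qed.

Lemma degree_top (v : snake_vertex a) : val v = rung_end N ->
  #|[set e in P | snake_inc e v]| = p (rung N) + incoming (p \o ne) N.
Proof.
move=> vE; rewrite (@vertex_degree _ (level_edges N)) ?level_edges_uniq //.
  by rewrite vE count_at_top.
move=> e es ve; have := mem_level_edges es.
move: (level_ends ve); rewrite vE level_rung_end => -[eN|[<- //]].
have [] : level e.1 <= N /\ True; last by rewrite -eN ltnn.
split=> //; case/snake_edgeP: es => t tN; rewrite ?level_corner ?level_ne //.
exact: ltnW.
Qed.

(** Level t + 1 has two vertices. Their degrees add up to the number of selected
    edges below them plus the number above, so if one edge is selected below
    level t + 1 then one is selected above; the degree of [sw_end t] then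
    becomes the rule for tile t. Conversely the two conditions give back each
    degree. *)
Lemma perfect_matching_levels :
  perfect_matching (@snake_inc a) P <-> level_exact /\ tile_rule.
Proof.
split=> [/forallP P1 | [lev tile]].
  have D0 : p (rung 0) + p (sw 0) = 1.
    by rewrite -(@degree_origin (SeqSub corner0_snake)) //; apply/eqP/P1.
  have DU t (tN : t < N) : p (rung t) + incoming (p \o ne) t +
      (if straight t then p (ne t) : nat else p (rung t.+1) + p (sw t.+1)) = 1.
    rewrite -count_at_rung_end.
    rewrite -(@degree_at t _ (SeqSub (rung_end_snake (ltnW tN))))
      ?level_rung_end //.
    by apply/eqP/P1.
  have DV t (tN : t < N) : p (sw t) +
      (if straight t then p (rung t.+1) + p (sw t.+1) else p (ne t) : nat) = 1.
    rewrite -count_at_sw_end.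
    rewrite -(@degree_at t _ (SeqSub (sw_end_snake tN))) ?level_sw_end //.
    by apply/eqP/P1.
  have lev : level_exact.
    elim=> [_|t IH tN]; first by rewrite count_level_edges addn0.
    have := IH (ltnW tN); rewrite !count_level_edges /=.
    by have := DU t tN; have := DV t tN; case: straight => /=; lia.
  split=> // t tN.
  have := lev t (ltnW tN); have := lev t.+1 tN; rewrite !count_level_edges /=.
  by have := DU t tN; have := DV t tN; case: straight => /=; lia.
apply/forallP => v; have: vertex_spec (val v) by apply/snake_vertexP/valP.
move Ew: (val v) => w vw; case: vw Ew => [|t tN|t tN|] vE.
- rewrite degree_origin //.
  by have := lev 0 isT; rewrite count_level_edges addn0 => ->.
- rewrite (@degree_at t _ _ vE) ?level_rung_end // count_at_rung_end.
  have := lev t (ltnW tN); have := lev t.+1 tN; rewrite !count_level_edges /=.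
  by have := tile t tN; case: straight => /=; lia.
- rewrite (@degree_at t _ _ vE) ?level_sw_end // count_at_sw_end.
  have := lev t (ltnW tN); have := lev t.+1 tN; rewrite !count_level_edges /=.
  by have := tile t tN; case: straight => /=; lia.
- rewrite degree_top //; have := lev N (leqnn _).
  by rewrite count_level_edges contains_swN addn0 => ->.
Qed.

End Matching.

(** * Gluing the two ends *)

Lemma perfect_incident (P : {set snake_edge a}) w :
  perfect_matching (@snake_inc a) P -> w \in snake_vertices a ->
  exists e, [/\ contains P e, w \in ends e &
    forall e', contains P e' -> w \in ends e' -> e' = e].
Proof.
move=> /forallP P1 sw; have /cards1P[x /setP xE] := P1 (SeqSub sw).
have := xE x; rewrite !inE eqxx => /andP[xP wx].
exists (val x); split=> //; first by rewrite contains_val.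
move=> e' pe'; have es := contains_snake pe' => we'.
have pe : (SeqSub es) \in P by rewrite -contains_val.
by have := xE (SeqSub es); rewrite !inE pe /snake_inc /= we' => /esym/eqP <-.
Qed.

Lemma N_gt1 : 1 < N.
Proof.
rewrite /num_tiles; case: a a_gt0 a_nonempty a_even => [|x [|y s]] //=.
by case/and3P; lia.
Qed.

Local Notation A' := (black_end (exit_edge a)).
Local Notation B' := (white_end (exit_edge a)).

Lemma level_exit w : w \in ends (exit_edge a) -> 1 < level w.
Proof.
have := N_gt1; rewrite exit_edgeE ends_rung !inE => N1 /orP[] /eqP->.
  by rewrite level_corner.
by rewrite level_rung_end; lia.
Qed.

Lemma mem_exit_ends w : (w \in ends (exit_edge a)) = (w == A') || (w == B').
Proof.
rewrite /black_end /white_end !inE /=.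
by case: ifP => _ //; rewrite orbC.
Qed.

Lemma mem_ab_ends w : (w \in ends edge_ab) = (w == (0, 0)) || (w == (1, 0)).
Proof. by rewrite !inE. Qed.

Lemma level_ab w : w \in ends edge_ab -> level w < 2.
Proof. by rewrite mem_ab_ends => /orP[] /eqP->. Qed.

Lemma ab_exit w : w \in ends edge_ab -> w \in ends (exit_edge a) -> false.
Proof. by move=> /level_ab + /level_exit; lia. Qed.

Lemma ab_neq_exit : (edge_ab == exit_edge a) = false.
Proof. by rewrite exit_edgeE edge_abE rung_eq; have := N_gt1; case: N. Qed.

Lemma white_black_exit : (B' == A') = false.
Proof.
have F d v : (step d v == v) = false.
  by apply: level_neq; rewrite level_step neq_ltn ltnSn orbT.
by rewrite /black_end /white_end; case: ifP => _; [|rewrite eq_sym]; exact: F.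
Qed.

Lemma glue_A' : glue_vertex a A' = (0, 0).
Proof. by rewrite /glue_vertex eqxx. Qed.

Lemma glue_B' : glue_vertex a B' = (1, 0).
Proof. by rewrite /glue_vertex white_black_exit eqxx. Qed.

Lemma glue_id w : w \notin ends (exit_edge a) -> glue_vertex a w = w.
Proof.
by rewrite mem_exit_ends negb_or /glue_vertex => /andP[/negPf-> /negPf->].
Qed.

Lemma glue_ab w : w \in ends edge_ab -> glue_vertex a w = w.
Proof. by move=> wab; apply/glue_id/negP => /(ab_exit wab). Qed.

(** Each of the two classes created by the gluing has a representative on both
    glued edges. *)
Lemma glue_partner w : (w \in ends edge_ab) || (w \in ends (exit_edge a)) ->
  (exists2 w', w' \in ends edge_ab & glue_vertex a w' = glue_vertex a w) /\
  (exists2 w', w' \in ends (exit_edge a) & glue_vertex a w' = glue_vertex a w).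
Proof.
have gA : glue_vertex a (0, 0) = (0, 0) by apply: glue_ab.
have gB : glue_vertex a (1, 0) = (1, 0) by apply: glue_ab.
have eA : A' \in ends (exit_edge a) by rewrite mem_exit_ends eqxx.
have eB : B' \in ends (exit_edge a) by rewrite mem_exit_ends eqxx orbT.
have bA : (0, 0) \in ends edge_ab by [].
have bB : (1, 0) \in ends edge_ab by [].
have gA' := glue_A'; have gB' := glue_B'.
rewrite mem_ab_ends mem_exit_ends.
by case/orP=> /orP[] /eqP ->; split; first
  [ by exists (0, 0); rewrite ?gA ?gA' | by exists (1, 0); rewrite ?gB ?gB'
  | by exists A'; rewrite ?gA' ?gA | by exists B'; rewrite ?gB' ?gB ].
Qed.

(** Distinct vertices are identified only across the two glued edges. *)
Lemma glue_inj w w' : glue_vertex a w = glue_vertex a w' -> w != w' ->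
  (w \in ends edge_ab) && (w' \in ends (exit_edge a)) ||
  (w' \in ends edge_ab) && (w \in ends (exit_edge a)).
Proof.
have [we|we] := boolP (w \in ends (exit_edge a));
  have [we'|we'] := boolP (w' \in ends (exit_edge a)).
- move: we we'; rewrite !mem_exit_ends.
  by case/orP=> /eqP-> /orP[] /eqP->; rewrite ?eqxx // ?glue_A' ?glue_B'.
- rewrite (glue_id we') => <- _; rewrite andbT mem_ab_ends.
  move: we; rewrite mem_exit_ends.
  by case/orP=> /eqP->; rewrite ?glue_A' ?glue_B' orbT.
- rewrite (glue_id we) => -> _; rewrite andbT mem_ab_ends.
  move: we'; rewrite mem_exit_ends.
  by case/orP=> /eqP->; rewrite ?glue_A' ?glue_B'.
- by rewrite !glue_id // => ->; rewrite eqxx.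
Qed.

Lemma glue_edge_id e : e != exit_edge a -> glue_edge a e = e.
Proof. by rewrite /glue_edge => /negPf->. Qed.

Lemma band_edge_snake (x : band_edge a) :
  val x \in snake_edges a /\ val x != exit_edge a.
Proof.
have /mapP[e es ->] := valP x; rewrite /glue_edge; case: ifP => [_|/negbT] //.
by rewrite ab_neq_exit edge_abE rung_snake.
Qed.

Lemma mem_band_image (P : {set snake_edge a}) (x : band_edge a) :
  (x \in band_image P) =
  (if val x == edge_ab then contains P edge_ab && contains P (exit_edge a)
   else contains P (val x)).
Proof.
have [xs xe] := band_edge_snake x.
have to_x (y : snake_edge a) : val y = val x -> x = to_band y.
  by move=> yx; apply: val_inj; rewrite /= yx glue_edge_id.
rewrite /band_image; case: ifP => both.
  case: ifP => [/eqP xab|xab].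
    have /andP[/existsP[y /andP[yP /eqP yab]] _] := both.
    by rewrite (to_x y) ?imset_f // yab xab.
  apply/imsetP/existsP => [[y yP xy]|[y /andP[yP /eqP yx]]]; last first.
    by exists y => //; apply: to_x.
  exists y; rewrite yP; move: xab; rewrite xy /= /glue_edge.
  by case: ifP; rewrite ?eqxx.
case: ifP => [xab|xab].
  apply/negbTE/imsetP => -[y]; rewrite !inE negb_or => /and3P[_ + ye] xy.
  by move: xab; rewrite xy /= glue_edge_id // => ->.
apply/imsetP/existsP => [[y]|[y /andP[yP /eqP yx]]]; last first.
  by exists y; [rewrite !inE yP yx xab xe | apply: to_x].
rewrite !inE negb_or => /and3P[yP _ ye] xy.
by exists y; rewrite yP xy /= glue_edge_id.
Qed.

(** Away from the glued edge nothing changes. A vertex on the glued edge has one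
    representative on (ab) and one on (a'b'). If P contains both edges, both
    representatives are covered by them, that is by the single glued edge; if
    P contains only one, removing it frees the representative on that edge,
    while the other one is covered by another edge of P, which survives. *)
Lemma band_image_perfect (P : {set snake_edge a}) :
  perfect_matching (@snake_inc a) P ->
  contains P edge_ab || contains P (exit_edge a) ->
  perfect_matching (@band_inc a) (band_image P).
Proof.
move=> Pperf Pgood; apply/forallP => v; apply/cards1P.
set p := contains P; pose both := p edge_ab && p (exit_edge a).
have ends_sub e w : e \in [:: edge_ab; exit_edge a] -> w \in ends e ->
    w \in snake_vertices a.
  move=> eab; apply: mem_snake_vertices; move: eab.
  by rewrite !inE exit_edgeE edge_abE => /orP[] /eqP->; apply: rung_snake.
have [w [ws wv]] : exists w, w \in snake_vertices a /\ glue_vertex a w = val v.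
  by have /mapP[w ws ->] := valP v; exists w.
(* Among the representatives w of v, pick one whose covering edge e survives
   in the image. If P contains both glued edges, any w will do. *)
have [{ws wv} {}w [e [wv pe we euniq e_ok]]] :
    exists w, exists e, [/\ glue_vertex a w = val v, p e, w \in ends e,
      forall e', p e' -> w \in ends e' -> e' = e &
      both || (e \notin [:: edge_ab; exit_edge a])].
  have find w1 : w1 \in snake_vertices a -> glue_vertex a w1 = val v ->
      both || ~~ (p edge_ab && (w1 \in ends edge_ab)) &&
              ~~ (p (exit_edge a) && (w1 \in ends (exit_edge a))) ->
      exists w, exists e, [/\ glue_vertex a w = val v, p e, w \in ends e,
        forall e', p e' -> w \in ends e' -> e' = e &
        both || (e \notin [:: edge_ab; exit_edge a])].
    move=> w1s w1v w1ok; have [e [pe we eu]] := perfect_incident Pperf w1s.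
    exists w1, e; split=> //; case: both w1ok => //= /andP[w1ab w1ex].
    rewrite !inE; apply/norP; split; apply/eqP => E.
      by case/negP: w1ab; rewrite -E; apply/andP.
    by case/negP: w1ex; rewrite -E; apply/andP.
  have [|wgen] := boolP ((w \in ends edge_ab) || (w \in ends (exit_edge a)));
    last first.
    apply: (find w) => //; move: wgen.
    rewrite negb_or => /andP[/negPf-> /negPf->].
    by rewrite !andbF orbT.
  case/glue_partner => -[w1 w1ab w1w] [w2 w2ex w2w].
  have [pab|pab] := boolP (p edge_ab).
    apply: (find w2); rewrite ?w2w //.
      by apply: ends_sub w2ex; rewrite !inE eqxx orbT.
    rewrite /both pab /=; case: (p _) => //=; rewrite andbT.
    by apply/negP => /ab_exit /(_ w2ex).
  apply: (find w1); rewrite ?w1w //.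
    by apply: (ends_sub _ _ _ w1ab); rewrite !inE eqxx.
  rewrite (negPf pab) /=; apply/orP; right.
  by apply/negP => /andP[_ /(ab_exit w1ab)].
have es : e \in snake_edges a by apply: contains_snake pe.
pose x0 : band_edge a := to_band (SeqSub es).
exists x0; apply/setP => x; rewrite !inE; apply/andP/eqP => [[xS xv]|->].
  apply: val_inj => /=; move: xv; rewrite /band_inc => /mapP[w' w'x w'v].
  have [xs xe] := band_edge_snake x; rewrite mem_band_image in xS.
  have px : p (val x) by move: xS; case: ifP => [/eqP-> /andP[]|].
  have [ww'|ww'] := eqVneq w w'.
    by rewrite -(euniq (val x)) ?glue_edge_id // ww'.
  have uniq_at e1 e2 w1 : p e1 -> p e2 ->
      w1 \in ends e1 -> w1 \in ends e2 -> e1 = e2.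
    move=> p1 p2 w1e1 w1e2.
    have w1s : w1 \in snake_vertices a.
      exact: mem_snake_vertices (contains_snake p1) w1e1.
    have [e0 [_ _ e0u]] := perfect_incident Pperf w1s.
    by rewrite (e0u e1) // (e0u e2).
  (* Two distinct representatives: each is covered by the glued edge at its own
     end, if that edge is in P. *)
  have ww_ends := glue_inj (etrans wv w'v) ww'.
  case: (boolP both) e_ok xS => [|nboth] /=.
    move=> /andP[pab pex] _ _; case/orP: ww_ends => /andP[w_ab w_ex].
      by case/eqP: xe; apply: (uniq_at _ _ w').
    rewrite (uniq_at e _ w pe pex we w_ex) /glue_edge eqxx.
    exact: (uniq_at _ _ w').
  move=> /[!inE] /norP[eab eex].
  rewrite -/p -/both (negPf nboth); case: ifP => // xab _.
  case/orP: Pgood => [pab|pex]; case/orP: ww_ends => /andP[w_ab w_ex].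
  - by case/eqP: eab; apply: (uniq_at _ _ w).
  - by case/eqP: xab; apply: (uniq_at _ _ w').
  - by case/eqP: xe; apply: (uniq_at _ _ w').
  - by case/eqP: eex; apply: (uniq_at _ _ w).
have [e_exit|eex] := eqVneq e (exit_edge a).
  have x0E : val x0 = edge_ab by rewrite /= /glue_edge e_exit eqxx.
  rewrite mem_band_image /band_inc x0E eqxx; split.
    by move: e_ok; rewrite e_exit !inE eqxx orbT orbF.
  have [|[w' w'ab w'w] _] := @glue_partner w; first by rewrite -e_exit we orbT.
  by rewrite -wv -w'w map_f.
have x0E : val x0 = e by rewrite /= glue_edge_id.
rewrite mem_band_image /band_inc x0E; split; last by rewrite -wv map_f.
by move: e_ok; rewrite !inE (negPf eex) orbF; case: ifP => [_|]; rewrite ?orbF.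
Qed.

(** * Good matchings as height functions *)

(** A height function h gives the multiplicities of the edges [sw t] in a sum
    of m good matchings. Those of the edges [ne t] follow by the rule for
    tiles. *)
Definition ne_height (m : nat) (h : nat -> nat) (t : nat) : nat :=
  if straight t then h t else m - h t.
(** The rung of level t takes what [ne (t - 1)] and [sw t] leave of the m units
    of this level; at the merged level 0 the predecessor of tile 0 is the last
    tile. The level of its starting point recovers the index of an edge. *)
Definition multiplicity (m : nat) (h : nat -> nat) (e : grid_edge) : nat :=
  let t := level e.1 in
  if e == sw t then h t
  else if e == rung t then m - (ne_height m h (cyclic_pred N t) + h t)
  else ne_height m h t.-1.
(** The second inequality says that the truncated subtraction in [multiplicity]
    is exact, hence that rungs have a nonnegative multiplicity. *)
Definition admissible (m : nat) (h : nat -> nat) : bool :=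
  all (fun t => (h t <= m) && (ne_height m h (cyclic_pred N t) + h t <= m))
      (iota 0 N).

Lemma admissibleP m h :
  reflect (forall t, t < N ->
             h t <= m /\ ne_height m h (cyclic_pred N t) + h t <= m)
          (admissible m h).
Proof.
apply: (iffP allP) => [adm t tN|adm t].
  by apply/andP/adm; rewrite mem_iota.
by rewrite mem_iota => /adm[h_le ne_le]; apply/andP.
Qed.

Lemma cyclic_pred_lt t : t < N -> cyclic_pred N t < N.
Proof. by case: t => [_|t /ltnW] //=; rewrite prednK ?N_gt0. Qed.

Lemma multiplicity_sw m h t : multiplicity m h (sw t) = h t.
Proof. by rewrite /multiplicity level_corner eqxx. Qed.
Lemma multiplicity_rung m h t :
  multiplicity m h (rung t) = m - (ne_height m h (cyclic_pred N t) + h t).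
Proof. by rewrite /multiplicity level_corner edge_eqE eqxx. Qed.
Lemma multiplicity_ne m h t : multiplicity m h (ne t) = ne_height m h t.
Proof. by rewrite /multiplicity level_ne !edge_eqE. Qed.
Definition multiplicityE :=
  (multiplicity_sw, multiplicity_rung, multiplicity_ne).

Variant band_edge_spec : grid_edge -> Prop :=
| BandRung t of t < N : band_edge_spec (rung t)
| BandSw t of t < N : band_edge_spec (sw t)
| BandNe t of t < N : band_edge_spec (ne t).

Lemma band_edgeP (x : band_edge a) : band_edge_spec (val x).
Proof.
have [xs] := band_edge_snake x; rewrite exit_edgeE.
case: (snake_edgeP xs) => t tN; try by constructor.
by rewrite rung_eq => t_neq; constructor; rewrite ltn_neqAle t_neq.
Qed.

Lemma eq_multiplicity m h h' e : (forall t, t < N -> h t = h' t) ->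
  band_edge_spec e -> multiplicity m h e = multiplicity m h' e.
Proof.
move=> hh' [] t tN; rewrite !multiplicityE /ne_height ?hh' //.
exact: cyclic_pred_lt.
Qed.

(** At the merged level, [sw 0] or [rung 0] is selected at one end and
    [ne N.-1] or [rung N] at the other. A good matching avoids the choice of
    [sw 0] together with [ne N.-1], and the glued edge is kept when both rungs
    are selected: in each case one edge remains. *)
Lemma snake_heights (P : {set snake_edge a})
    (h := fun t => contains P (sw t) : nat) :
  perfect_matching (@snake_inc a) P ->
  contains P edge_ab || contains P (exit_edge a) ->
  admissible 1 h /\
  forall x : band_edge a,
    (x \in band_image P) = multiplicity 1 h (val x) :> nat.
Proof.
move=> /(perfect_matching_levels P)[lev tile].
rewrite exit_edgeE edge_abE => Pgood.
have neE t : t < N -> ne_height 1 h t = contains P (ne t).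
  move=> tN; rewrite /ne_height tile // /h.
  by case: straight => //; case: contains.
have lev0 : contains P (rung 0) + contains P (sw 0) = 1.
  by have := lev 0 isT; rewrite count_level_edges addn0.
have levN : contains P (rung N) + contains P (ne N.-1) = 1.
  have := lev N (leqnn _); rewrite count_level_edges contains_swN addn0.
  by case: N N_gt0.
have levS t : t.+1 < N ->
    contains P (rung t.+1) + contains P (sw t.+1) + contains P (ne t) = 1.
  by move=> tN; have := lev t.+1 (ltnW tN); rewrite count_level_edges.
split.
  apply/admissibleP => t tN; rewrite neE ?cyclic_pred_lt //; split.
    by rewrite /h; case: contains.
  case: t tN => [|t] tN /=; last by have := levS t tN; rewrite /h; lia.
  by rewrite /h; lia.
move=> x; rewrite mem_band_image exit_edgeE edge_abE.
case: (band_edgeP x) => t tN;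
  rewrite multiplicityE edge_eqE ?neE ?cyclic_pred_lt //.
case: t tN => [|t] tN /=; first by rewrite /h; lia.
by have := levS t tN; rewrite /h; lia.
Qed.

(** The snake matching that encodes h. Unlike in the band, the rungs 0 and N
    compete with one edge only, as their levels are not merged. *)
Definition snake_choice (h : nat -> nat) (e : grid_edge) : bool :=
  let t := level e.1 in
  if e == sw t then 0 < h t
  else if e == rung t then
    ((t == 0) || (ne_height 1 h t.-1 == 0)) && ((t == N) || (h t == 0))
  else 0 < ne_height 1 h t.-1.

Lemma snake_of_heights h : admissible 1 h ->
  exists P : {set snake_edge a},
    [/\ perfect_matching (@snake_inc a) P,
        contains P edge_ab || contains P (exit_edge a) &
        forall t, t < N -> contains P (sw t) = h t :> nat].
Proof.
move=> /admissibleP adm.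
pose P : {set snake_edge a} := [set x | snake_choice h (val x)].
have PE e : e \in snake_edges a -> contains P e = snake_choice h e.
  by move=> es; rewrite -[e]/(val (SeqSub es)) contains_val inE.
have Psw t : t < N -> contains P (sw t) = (0 < h t).
  by move=> tN; rewrite PE ?sw_snake // /snake_choice level_corner eqxx.
have Pne t : t < N -> contains P (ne t) = (0 < ne_height 1 h t).
  by move=> tN; rewrite PE ?ne_snake // /snake_choice level_ne !edge_eqE.
have Prung t : t <= N -> contains P (rung t) =
    ((t == 0) || (ne_height 1 h t.-1 == 0)) && ((t == N) || (h t == 0)).
  move=> tN; rewrite PE ?rung_snake // /snake_choice level_corner.
  by rewrite edge_eqE eqxx.
have ne_le t : t < N -> ne_height 1 h t <= 1.
  by move=> tN; rewrite /ne_height; have [] := adm t tN; case: straight; lia.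
exists P; split.
- apply/perfect_matching_levels; split=> [t tN|t tN]; last first.
    rewrite Pne // Psw // /ne_height; have [] := adm t tN; case: straight; lia.
  rewrite count_level_edges; case: t tN => [_|t tN].
    rewrite Prung // Psw ?N_gt0 //=.
    by rewrite eq_sym gtn_eqF ?N_gt0 //=; lia.
  rewrite /= Prung // Pne //=; move: tN; rewrite leq_eqVlt => /predU1P[tN|tN].
    rewrite tN contains_swN eqxx andbT.
    by have := ne_le t; rewrite -tN ltnSn => /(_ isT); lia.
  by rewrite Psw // (ltn_eqF tN) /=; have := adm t.+1 tN; rewrite /=; lia.
- rewrite edge_abE exit_edgeE !Prung // !eqxx !orTb andTb andbT.
  rewrite (ltn_eqF N_gt0) (gtn_eqF N_gt0) !orFb.
  by have [_ /=] := adm 0 N_gt0; lia.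
- by move=> t tN; rewrite Psw //; have := adm t tN; lia.
Qed.

Lemma good_matchingP (S : {set band_edge a}) :
  good_matching S <->
  exists2 h, admissible 1 h &
    forall x : band_edge a, (x \in S) = multiplicity 1 h (val x) :> nat.
Proof.
split=> [/andP[_ /existsP[P /and3P[Pp Pgood /eqP ->]]]|[h adm Sh]].
  by have [admP PE] := snake_heights Pp Pgood; eexists; [exact: admP|].
have [P [Pp Pgood Ph]] := snake_of_heights adm.
have [_ PE] := snake_heights Pp Pgood.
have SP : S = band_image P.
  apply/setP => x; apply: (can_inj oddb).
  by rewrite Sh PE; apply: eq_multiplicity (band_edgeP x) => t /Ph.
apply/andP; split; first by rewrite SP band_image_perfect.
by apply/existsP; exists P; rewrite Pp Pgood SP eqxx.
Qed.

(** * Sums of good matchings *)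

Lemma blockS t : t < N -> block a t.+1 = block a t + straight t.
Proof.
move=> tN; have r_lt := reshape_indexP tN; have c_lt := reshape_offsetP tN.
rewrite /straight /last_in_block /block.
have := reshape_indexK a t; rewrite -/(block a t) in r_lt c_lt *.
set r := block a t in r_lt c_lt *; set c := reshape_offset a t in c_lt *.
rewrite /flatten_index => tE; case: eqVneq => [c_last|c_next].
  have tE' : t.+1 = flatten_index a r.+1 0.
    by rewrite /flatten_index (take_nth 0) // sumn_rcons; lia.
  have [r_next|r_last] := ltnP r.+1 (size a).
    by rewrite tE' flatten_indexKl ?addn1 // (allP a_gt0) // mem_nth.
  have -> : t.+1 = sumn a.
    by rewrite tE' /flatten_index take_oversize // addn0.
  by rewrite reshape_index_sumn; lia.
have -> : t.+1 = flatten_index a r c.+1 by rewrite /flatten_index; lia.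
by rewrite flatten_indexKl ?addn0 // ltn_neqAle c_next.
Qed.

(** The label changes exactly after the last tile of a block, and does so
    cyclically because the number of blocks is even. *)
Lemma label_cyclic t : t < N ->
  label t = label (cyclic_pred N t) (+) straight (cyclic_pred N t).
Proof.
have labelS s : s < N -> label s.+1 = label s (+) straight s.
  by move=> sN; rewrite /label blockS // oddD oddb.
case: t => [_|t /ltnW /labelS //]; rewrite -labelS prednK ?N_gt0 //.
rewrite /label [block a N]reshape_index_sumn (negPf a_even).
suff -> : block a 0 = 0 by [].
have := @flatten_indexKl a 0 0; rewrite /flatten_index take0; apply.
by rewrite (allP a_gt0) // mem_nth.
Qed.

(** The i-th threshold of h where the label is [false], and the complement of
    the i-th threshold of m - h where it is [true]. In terms of h on the former
    tiles and m - h on the latter, admissibility compares consecutive tiles in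
    a direction that depends on the label only, and thresholds preserve such
    comparisons. *)
Definition slice (m : nat) (h : nat -> nat) (i t : nat) : nat :=
  if label t then m - h t <= i else i < h t.

Lemma slice_admissible m h i : admissible m h -> i < m ->
  admissible 1 (slice m h i).
Proof.
move=> /admissibleP adm im; apply/admissibleP => t tN.
have := label_cyclic tN; have [h_t] := adm t tN.
have [h_pred _] := adm _ (cyclic_pred_lt tN).
rewrite /ne_height /slice; case: straight => /=.
  by rewrite addbT => + -> /=; case: label => /=; lia.
by rewrite addbF => + ->; case: label => /=; lia.
Qed.

Lemma sum_slice m h t : h t <= m -> \sum_(i < m) slice m h i t = h t.
Proof.
have sum_lt k n : \sum_(i < n) (i < k) = minn k n.
  by elim: n => [|n IH]; rewrite ?big_ord0 ?minn0 // big_ord_recr /= IH; lia.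
have sum_ge k n : \sum_(i < n) (k <= i) = n - k.
  by elim: n => [|n IH]; rewrite ?big_ord0 // big_ord_recr /= IH; lia.
by rewrite /slice => htm; case: label; rewrite ?sum_ge ?sum_lt; lia.
Qed.

Lemma sum_ne_height m (hs : 'I_m -> nat -> nat) t :
  (forall i, hs i t <= 1) ->
  \sum_(i < m) ne_height 1 (hs i) t =
  ne_height m (fun s => \sum_(i < m) hs i s) t.
Proof.
rewrite /ne_height => hs1; case: straight => //.
by rewrite sumnB // sum1_card card_ord.
Qed.

(** All multiplicities are affine in h, with the constant proportional to m. *)
Lemma sum_heights m (hs : 'I_m -> nat -> nat)
    (h := fun t => \sum_(i < m) hs i t) :
  (forall i, admissible 1 (hs i)) ->
  admissible m h /\
  forall e, band_edge_spec e ->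
    multiplicity m h e = \sum_(i < m) multiplicity 1 (hs i) e.
Proof.
move=> adm.
have hs1 i t : t < N -> hs i t <= 1 by case/(admissibleP _ _ (adm i)).
have hs2 i t : t < N -> ne_height 1 (hs i) (cyclic_pred N t) + hs i t <= 1.
  by case/(admissibleP _ _ (adm i)).
have sum1m (F : 'I_m -> nat) : (forall i, F i <= 1) -> \sum_(i < m) F i <= m.
  by move=> F1; rewrite -[leqRHS]card_ord -sum1_card leq_sum.
have neE t : t < N -> ne_height m h t = \sum_(i < m) ne_height 1 (hs i) t.
  by move=> tN; rewrite sum_ne_height // => i; apply: hs1.
split=> [|_ [] t tN].
- apply/admissibleP => t tN; split; first by apply: sum1m => i; apply: hs1.
  by rewrite neE ?cyclic_pred_lt // -big_split sum1m // => i; apply: hs2.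
- under eq_bigr do rewrite multiplicity_rung.
  rewrite multiplicity_rung neE ?cyclic_pred_lt // -big_split.
  by rewrite sumnB ?sum1_card ?card_ord // => i _; apply: hs2.
- by under eq_bigr do rewrite multiplicity_sw; rewrite multiplicity_sw.
- by under eq_bigr do rewrite multiplicity_ne; rewrite multiplicity_ne neE.
Qed.

(** Heights add up by [sum_heights], and are cut into m slices for the
    converse. *)
Lemma good_dimer_coverP m (M : {ffun band_edge a -> 'I_m.+1}) :
  good_dimer_cover M <->
  exists2 h, admissible m h & forall x, M x = multiplicity m h (val x) :> nat.
Proof.
split=> [/existsP[P /andP[/forallP Pgood /forallP PM]]|[h adm Mh]].
  have /fin_all_exists[hs hsP] : forall i, exists h, admissible 1 h /\
      forall x : band_edge a, (x \in P i) = multiplicity 1 h (val x) :> nat.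
    by move=> i; have /good_matchingP[h] := Pgood i; exists h.
  have [|adm multE] := @sum_heights m hs; first by move=> i; have [] := hsP i.
  eexists; first exact: adm.
  move=> x; have /eqP -> := PM x; rewrite multE; last exact: band_edgeP.
  by apply: eq_bigr => i _; have [_ ->] := hsP i.
pose S i := [set x : band_edge a | 0 < multiplicity 1 (slice m h i) (val x)].
have adm1 (i : 'I_m) : admissible 1 (slice m h i) by apply: slice_admissible.
have SE (i : 'I_m) x :
    (x \in S i) = multiplicity 1 (slice m h i) (val x) :> nat.
  suff : multiplicity 1 (slice m h i) (val x) <= 1 by rewrite inE; lia.
  have /admissibleP adm_i := adm1 i.
  case: (band_edgeP x) => t tN; rewrite multiplicityE; first exact: leq_subr.
    by have [] := adm_i t tN.
  by have [s_le _] := adm_i t tN; rewrite /ne_height; case: straight; lia.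
apply/existsP; exists [ffun i : 'I_m => S i]; apply/andP; split; apply/forallP.
  by move=> i; rewrite ffunE; apply/good_matchingP; exists (slice m h i).
move=> x; apply/eqP; rewrite /= Mh.
under eq_bigr do rewrite ffunE SE.
have [_ <-] := sum_heights adm1; last exact: band_edgeP.
apply: eq_multiplicity (band_edgeP x) => t tN.
by rewrite sum_slice //; have /admissibleP/(_ t tN)[] := adm.
Qed.

(** * The partition function as a sum over heights *)

Lemma multiplicity_le m h e : admissible m h -> band_edge_spec e ->
  multiplicity m h e <= m.
Proof.
move=> /admissibleP adm [] t tN; rewrite multiplicityE ?leq_subr //.
  by have [] := adm t tN.
have [h_le _] := adm t tN.
by rewrite /ne_height; case: straight; rewrite ?leq_subr.
Qed.

Lemma sw_band (t : 'I_N) : sw t \in [seq glue_edge a e | e <- snake_edges a].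
Proof.
rewrite -[X in X \in _](@glue_edge_id (sw t)) ?map_f ?sw_snake //.
by rewrite exit_edgeE edge_eqE.
Qed.
Definition band_sw (t : 'I_N) : band_edge a := SeqSub (sw_band t).

Section Covers.
Variable m : nat.

Definition heights (l : N.-tuple 'I_m.+1) (t : nat) : nat := nth ord0 l t.

Definition cover_of (l : N.-tuple 'I_m.+1) : {ffun band_edge a -> 'I_m.+1} :=
  [ffun x => inord (multiplicity m (heights l) (val x))].
Definition heights_of (M : {ffun band_edge a -> 'I_m.+1}) : N.-tuple 'I_m.+1 :=
  [tuple M (band_sw t) | t < N].

Lemma heights_tnth l (t : 'I_N) : heights l t = tnth l t.
Proof. by rewrite /heights (tnth_nth ord0). Qed.

Lemma cover_ofE l x : admissible m (heights l) ->
  cover_of l x = multiplicity m (heights l) (val x) :> nat.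
Proof.
move=> adm; rewrite ffunE inordK // ltnS multiplicity_le //.
exact: band_edgeP.
Qed.

Lemma heights_ofE M t (tN : t < N) :
  heights (heights_of M) t = M (band_sw (Ordinal tN)).
Proof. by rewrite -[t]/(val (Ordinal tN)) heights_tnth tnth_mktuple. Qed.

(** A cover determines its heights, being the multiplicities of the edges
    [sw t], so distinct admissible heights give distinct covers. *)
Lemma sum_covers (R : nmodType) (F : {ffun band_edge a -> 'I_m.+1} -> R) :
  (\sum_(M | good_dimer_cover M) F M =
   \sum_(l | admissible m (heights l)) F (cover_of l))%R.
Proof.
have coverP M : good_dimer_cover M ->
    admissible m (heights (heights_of M)) /\ cover_of (heights_of M) = M.
  move=> /good_dimer_coverP[h adm Mh].
  have hE t : t < N -> heights (heights_of M) t = h t.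
    by move=> tN; rewrite heights_ofE Mh multiplicity_sw.
  have adm' : admissible m (heights (heights_of M)).
    apply/admissibleP => t tN; rewrite /ne_height !hE ?cyclic_pred_lt //.
    by move: t tN; apply/admissibleP.
  split=> //; apply/ffunP => x; apply: val_inj; rewrite /= cover_ofE // Mh.
  exact: eq_multiplicity (band_edgeP x).
rewrite (reindex_onto cover_of heights_of) => [|M /coverP[] //].
have heights_ofK l : admissible m (heights l) -> heights_of (cover_of l) = l.
  move=> adm; apply: eq_from_tnth => t; apply: val_inj.
  by rewrite tnth_mktuple /= cover_ofE // multiplicity_sw heights_tnth.
apply: eq_bigl => l; apply/andP/idP => [[/coverP[adm _] /eqP <-] //|adm].
rewrite heights_ofK // eqxx; split=> //; apply/good_dimer_coverP.
by exists (heights l) => // x; apply: cover_ofE.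
Qed.

Lemma count_tiles_sw t : t < N ->
  count (fun s => sw t \in tile_edges a s) (iota 0 N) = 1.
Proof.
move=> tN; rewrite (eq_count (a2 := pred1 t)); last first.
  by move=> s; rewrite mem_tile_edges !edge_eqE !orbF /= eq_sym.
by rewrite count_uniq_mem ?iota_uniq // mem_iota tN.
Qed.

Lemma rung_not_boundary t : 0 < t < N -> boundary a (rung t) = false.
Proof.
case: t => // t /andP[_ tN]; rewrite /boundary.
rewrite (eq_count (a2 := predU (pred1 t.+1) (pred1 t))); last first.
  move=> s; rewrite mem_tile_edges !edge_eqE /= eqSS.
  by rewrite ![_ == s]eq_sym.
have := count_predUI (pred1 t.+1) (pred1 t) (iota 0 N).
rewrite (eq_count (a2 := pred0) (a1 := predI _ _)) ?count_pred0; last first.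
  by move=> s /=; apply/negbTE/negP => /andP[/eqP-> /eqP]; lia.
rewrite !count_uniq_mem ?iota_uniq // !mem_iota /= add0n tN (ltnW tN) addn0.
by move=> ->.
Qed.

Lemma is_south_westE b e : is_south_west a b e =
  has (fun t => (label t == b) && ((e == rung t) || (e == sw t))) (iota 0 N).
Proof.
apply: eq_has => t; congr andb; rewrite !inE /rung /sw /south_edge /west_edge.
by case: dir; rewrite // orbC.
Qed.

(** Rungs are interior edges (or (ab) itself), and an edge [ne t] is a south or
    west side of no tile, so only the edges [sw t] carry a weight. *)
Lemma sw_weight_band (R : comUnitRingType) (q : R) e : band_edge_spec e ->
  sw_weight a q e =
  if e == sw (level e.1) then (if label (level e.1) then q^-1 else q)%R
  else 1%R.
Proof.
case=> t tN; rewrite /sw_weight ?level_ne ?level_corner !edge_eqE ?eqxx.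
- case: (posnP t) => [->|t_gt0]; first by rewrite edge_abE eqxx orbT.
  by rewrite rung_not_boundary // t_gt0.
- rewrite /boundary count_tiles_sw // edge_abE edge_eqE /=.
  have swE b : is_south_west a b (sw t) = (label t == b).
    rewrite is_south_westE; apply/hasP/idP => [[s _]|tb].
      by rewrite !edge_eqE /= => /andP[/eqP <- /eqP ->].
    by exists t; rewrite ?mem_iota // tb !eqxx orbT.
  by rewrite !swE; case: label.
- have neE b : is_south_west a b (ne t) = false.
    by rewrite is_south_westE; apply/hasP => -[s _]; rewrite !edge_eqE andbF.
  by rewrite !neE; case: ifP.
Qed.

Lemma cover_weight (R : comUnitRingType) (q : R) l : admissible m (heights l) ->
  (\prod_(x : band_edge a) sw_weight a q (val x) ^+ (cover_of l x) =
   \prod_(t < N) (if label t then q^-1 else q) ^+ heights l t)%R.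
Proof.
move=> adm; have band_sw_inj : injective band_sw.
  by move=> s t /(congr1 val) /eqP; rewrite /= edge_eqE => /eqP/val_inj.
rewrite (bigID (mem (band_sw @: setT))) /= [X in (_ * X)%R]big1 ?mulr1.
  rewrite big_imset /=; last by move=> s t _ _; apply: band_sw_inj.
  apply: eq_big => [t|t _]; first by rewrite inE.
  rewrite cover_ofE // multiplicity_sw sw_weight_band ?level_corner ?eqxx //.
  exact: BandSw.
move=> x x_sw; rewrite sw_weight_band; last exact: band_edgeP.
case: eqP => [xE|]; last by rewrite expr1n.
have sw_level e : band_edge_spec e -> e = sw (level e.1) -> level e.1 < N.
  by case=> t tN /eqP; rewrite ?level_ne ?level_corner ?edge_eqE.
have lN := sw_level _ (band_edgeP x) xE.
case/negP: x_sw; rewrite (_ : x = band_sw (Ordinal lN)) ?imset_f //.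
exact: val_inj.
Qed.

(** Exchanges closed walks and heights: positions are heights at letters L and
    complements of heights at letters R. *)
Definition flip (l : N.-tuple 'I_m.+1) : N.-tuple 'I_m.+1 :=
  [tuple (if label t then tnth l t else rev_ord (tnth l t)) | t < N].

Lemma flipK : involutive flip.
Proof.
move=> l; apply: eq_from_tnth => t; rewrite !tnth_mktuple.
by case: label => //; rewrite rev_ordK.
Qed.

Lemma flipE l t : t < N ->
  heights (flip l) t = if label t then heights l t else m - heights l t.
Proof.
move=> tN; rewrite -[t]/(val (Ordinal tN)) !heights_tnth tnth_mktuple.
by case: label; rewrite //= subSS.
Qed.

End Covers.

(** * Closed walks and admissible heights *)

Section Walks.
Local Open Scope ring_scope.
Variables (R : comUnitRingType) (q : R) (m : nat).
Hypothesis q_unit : q \is a GRing.unit.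

Definition letter (b : bool) : 'M[R]_m.+1 := if b then Lq m q else Rq m q.
Definition letter_factor (b : bool) : R := if b then q ^+ m else 1.

(** A letter R asks the walk to increase weakly, a letter L asks it to decrease
    weakly. In terms of heights both say that the rung of tile t has a
    nonnegative multiplicity, whichever the previous letter is. At a letter L
    the matrix contributes q^(m - h t), which is q^m times the weight. *)
Lemma walk_step (l : N.-tuple 'I_m.+1) (t : 'I_N) :
  letter (label t) (nth ord0 (flip l) (cyclic_pred N t)) (nth ord0 (flip l) t) =
  (ne_height m (heights l) (cyclic_pred N t) + heights l t <= m)%N%:R *
  (letter_factor (label t) * (if label t then q^-1 else q) ^+ heights l t).
Proof.
have h_le s : (heights l s <= m)%N by rewrite -ltnS ltn_ord.
have tN := ltn_ord t; have pN := cyclic_pred_lt tN.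
have := label_cyclic tN.
rewrite /letter /letter_factor (fun_if (fun M : 'M_m.+1 => M _ _)).
rewrite Rq_entry Lq_entry.
rewrite -/(heights (flip l) t) -/(heights (flip l) (cyclic_pred N t)).
rewrite (flipE l tN) (flipE l pN) /ne_height.
have := h_le t; have := h_le (cyclic_pred N t).
move: (heights l t) (heights l (cyclic_pred N t)) => x y y_m x_m.
have qB : q ^+ m * q^-1 ^+ x = q ^+ (m - x) by rewrite exprVn exprB.
case: (label t); case: (label (cyclic_pred N t)); case: (straight _) => //= _;
  by rewrite ?qB ?mul1r ?subKn //; congr ((nat_of_bool _)%:R * _); lia.
Qed.

Lemma walk_weight n (l : N.-tuple 'I_m.+1) : size a = n.*2 ->
  \prod_(t < N) letter (label t)
     (nth ord0 (flip l) (cyclic_pred N t)) (nth ord0 (flip l) t) =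
  if admissible m (heights l) then
    q ^+ (m * \sum_(i < n) nth 0%N a i.*2.+1) *
    \prod_(t < N) (if label t then q^-1 else q) ^+ heights l t
  else 0.
Proof.
move=> size_a; rewrite (eq_bigr _ (fun t _ => walk_step l t)).
rewrite big_split /= big_split /=.
have -> : \prod_(t < N) letter_factor (label t) =
    q ^+ (m * \sum_(i < n) nth 0%N a i.*2.+1).
  rewrite (prod_labels letter_factor size_a) exprM -prodrXr.
  by apply: eq_bigr => i _; rewrite expr1n mul1r.
case: ifP => [/admissibleP adm|adm].
  by rewrite big1 ?mul1r // => t _; have [_ ->] := adm t (ltn_ord t).
suff [t /negPf tF] : exists t : 'I_N,
    ~~ (ne_height m (heights l) (cyclic_pred N t) + heights l t <= m)%N.
  by rewrite (bigD1 t) //= tF !mul0r.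
apply/existsP; rewrite -negb_forall; apply: contraFN adm => /forallP adm.
apply/admissibleP => t tN; split; first by rewrite -ltnS ltn_ord.
exact: (adm (Ordinal tN)).
Qed.

End Walks.
End BandGraph.

Theorem theorem3p8 (R : comUnitRingType) (q : R) (m n : nat) (a : seq nat)
    (q_unit : (q \is a GRing.unit)%R) (m_gt0 : 0 < m) (n_gt0 : 0 < n)
    (size_a : size a = 2 * n) (a_gt0 : all (fun x => 0 < x) a) :
  good_partition a m q =
  (q ^- (m * \sum_(i < n) nth 0%N a i.*2.+1) * \tr (Xmx m q n a))%R.
Proof.
have size_a2 : size a = n.*2 by rewrite size_a mul2n.
have a_band : [&& all (fun x => 0 < x) a, 0 < size a & ~~ odd (size a)].
  by rewrite a_gt0 size_a2 double_gt0 n_gt0 odd_double.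
rewrite Xmx_word -(prod_labels (letter q m) size_a2).
rewrite (trace_prod_mx (fun t => letter q m (label a t))) ?N_gt0 //.
rewrite (reindex_inj (inv_inj (@flipK a m))) /=.
rewrite (eq_bigr _ (fun l _ => walk_weight a_band q_unit l size_a2)).
rewrite -big_mkcond /= -big_distrr /= mulKr ?unitrX //.
rewrite /good_partition (sum_covers a_band).
by apply: eq_bigr => l adm; rewrite (cover_weight a_band).
Qed.
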